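(* The principal generators $y_{ij}^{(r)}$ of the (twisted) Yangian $Y(\mathfrak{g}_N)$ satisfy the following relations, for all $i,j,k,l\in\mathbb{Z}_N$: $$\begin{aligned} &(u^2-v^2)[y_{ij}(u),y_{kl}(v)]=\\ &\frac{u+v}{N}\sum_{a,b}\bigl(\omega^{b(i-k-a)}y_{i-a,j-b}(u)y_{k+a,l+b}(v)-\omega^{a(j-l-b)}y_{k+a,l+b}(v)y_{i-a,j-b}(u)\bigr)\\ &+\frac{u-v}{N^2}\sum_{a,b,a',b'}\theta_{a'}\theta_{a'+b}\,\omega^{-a-a'(a+b')+b'(j-b)-b(k+a)}\,y_{i-b',j-b}(u)y_{k+a,l+b}(v)\\ &-\frac{u-v}{N^2}\sum_{a,b,a',b'}\theta_{a'}\theta_{a'+b}\,\omega^{-a-a'(a+b')+b(i-b')-a(l+b)}\,y_{k+a,l+b}(v)y_{i-b',j-b}(u)\\ &+\frac{1}{N^3}\sum_{a,b,a',b',c,d}\theta_{a'}\theta_{a'+b}\,\omega^{-a-a'(a+b')+b'(j-b-d)+b(k+a+c)+d(i-k-c)}\,y_{i-c-b',j-d-b}(u)y_{k+a+c,l+b+d}(v)\\ &-\frac{1}{N^3}\sum_{a,b,a',b',c,d}\theta_{a'}\theta_{a'+b}\,\omega^{-a-a'(a+b')+b(i-a-b')+a(l+b+d)+c(j-l-d)}\,y_{k+a+c,l+b+d}(v)y_{i-c-b',j-d-b}(u), \end{aligned}$$ and the symmetric relation $$\frac{1}{N}\sum_{k,l}\theta_{k}\theta_{k+j}\,\omega^{-l(1+j)-k(i+l)}y_{l,j}(-u)=y_{ij}(u)\pm\frac{y_{ij}(u)-y_{ij}(-u)}{2u}.$$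 In particular, when $\mathfrak{g}_N=\mathfrak{so}_N$ the defining relations can be reduced to the following relations: $$\begin{aligned} &(u^2-v^2)[y_{ij}(u),y_{kl}(v)]=\\ &\frac{u+v}{N}\sum_{a,b}\bigl(\omega^{b(i-k-a)}y_{i-a,j-b}(u)y_{k+a,l+b}(v)-\omega^{a(j-l-b)}y_{k+a,l+b}(v)y_{i-a,j-b}(u)\bigr)\\ &+\frac{u-v}{N}\sum_{a,b}\bigl(\omega^{-a+bi-la}y_{k+a,l+b}(v)y_{i+a,j-b}(u)-\omega^{-a-aj-bk}y_{i+a,j-b}(u)y_{k+a,l+b}(v)\bigr)\\ &+\frac{1}{N^2}\sum_{a,b,a',b'}\omega^{-a-aj+b'(a-k+i-a')+b(k+a')}\,y_{i+a-a',j-b-b'}(u)y_{k+a+a',l+b+b'}(v)\\ &-\frac{1}{N^2}\sum_{a,b,a',b'}\omega^{-a+bi+a'(j-b-b'-l)-a(l+b')}\,y_{k+a+a',l+b+b'}(v)y_{i+a-a',j-b-b'}(u) \end{aligned}$$ and the symmetric relation $$\omega^{i(1+j)}y_{-i,j}(-u)=y_{ij}(u)+\frac{1}{2u}\bigl(y_{ij}(u)-y_{ij}(-u)\bigr).$$ All sums run over $\mathbb{Z}_N$ in each summation index.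
   Context: Indices lie in $\mathbb{Z}_N=\{0,1,\dots,N-1\}$, with index arithmetic (also in the indices of $\theta$) modulo $N$; $i'=N-1-i$ when applied to a matrix index in the definition below; $\omega=e^{2\pi\sqrt{-1}/N}$; $E_{ij}$ are the $N\times N$ matrix units over $\mathbb{C}$; $A_{kl}=\sum_{m\in\mathbb{Z}_N}\omega^{mk}E_{m,m+l}$. Two cases are treated: in the symmetric case ($\mathfrak{g}_N=\mathfrak{so}_N$), $\theta_i=1$ for all $i$; in the alternating case ($\mathfrak{g}_N=\mathfrak{sp}_N$), $N=2n$ is even and $\theta_i=-1$ for $0\le i\le n-1$, $\theta_i=1$ for $n\le i\le 2n-1$. In a double sign $\pm$ the upper sign is for $\mathfrak{so}_N$, the lower for $\mathfrak{sp}_N$. The twisted Yangian $Y(\mathfrak{g}_N)$ is the unital associative algebra over $\mathbb{C}$ with generators $s_{ij}^{(r)}$ ($i,j\in\mathbb{Z}_N$, $r\ge 1$) and, with $s_{ij}(u)=\delta_{ij}+\sum_{r\ge 1}s_{ij}^{(r)}u^{-r}$, the defining relations $$\begin{aligned}(u^2-v^2)[s_{ij}(u),s_{kl}(v)]={}&(u+v)\bigl(s_{kj}(u)s_{il}(v)-s_{kj}(v)s_{il}(u)\bigr)\\&-(u-v)\bigl(\theta_k\theta_{j'}s_{ik'}(u)s_{j'l}(v)-\theta_i\theta_{l'}s_{ki'}(v)s_{l'j}(u)\bigr)\\&+\theta_i\theta_{j'}\bigl(s_{ki'}(u)s_{j'l}(v)-s_{ki'}(v)s_{j'l}(u)\bigr)\end{aligned}$$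 and $$\theta_i\theta_js_{j'i'}(-u)=s_{ij}(u)\pm\frac{s_{ij}(u)-s_{ij}(-u)}{2u}.$$ Equivalently, put $E_{ij}^t=\theta_i\theta_jE_{N-1-j,N-1-i}$ (extended linearly to a transposition $t$), $P=\sum E_{ij}\otimes E_{ji}$, $Q=\sum E_{ij}^t\otimes E_{ji}$, $R(u)=1-Pu^{-1}$, $R^t(u)=1-Qu^{-1}$, $S(u)=\sum_{i,j}s_{ij}(u)\otimes E_{ij}$, and let $S_1(u),S_2(u)$ denote $S(u)$ with matrix part in the first, second copy of $\mathrm{End}\,\mathbb{C}^N$; the relations read $R(u-v)S_1(u)R^t(-u-v)S_2(v)=S_2(v)R^t(-u-v)S_1(u)R(u-v)$ and $S^t(-u)=S(u)\pm\frac{S(u)-S(-u)}{2u}$. The principal generators $y_{kl}^{(r)}$ are the coefficients of the series $y_{kl}(u)=\sum_{r\ge 0}y_{kl}^{(r)}u^{-r}$ defined by $$S(u)=\sum_{i,j}s_{ij}(u)\otimes E_{ij}=\sum_{k,l\in\mathbb{Z}_N}y_{kl}(u)\otimes A_{kl},$$ so that $y^{(0)}_{kl}=\delta_{k,0}\delta_{l,0}$. In the summations of the claim, $a',b'$ are independent summation indices (not $N-1-a$, $N-1-b$).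
   Formalization: Misprints corrected: the signs of the two (u-v)/N^2 sums are exchanged; in the 1/N^3 sums +b(k+a+c) becomes -b(k+a+c), and +b(i-a-b')+a(l+b+d) becomes +b(i-c-b')-a(l+b+d); in the so_N relation +b(k+a') becomes -b(k+a'). *)

(* Defs.v *)
From HB Require Import structures.
From mathcomp Require Import all_boot all_order all_algebra.
From mathcomp Require Import ring lra.
From mathcomp Require Import boolp functions reals trigo complex.
From mathcomp Require finmap.
From mathcomp.multinomials Require Import monalg.

Set Implicit Arguments.
Unset Strict Implicit.
Unset Printing Implicit Defensive.

Import Order.TTheory GRing.Theory Num.Theory.
Local Open Scope ring_scope.
Local Open Scope quotient_scope.

Section PresentedAlgebra.
Variables (K : comNzRingType) (A : algType K) (relator : A -> Prop).

Inductive two_sided_ideal : A -> Prop :=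
| ideal_zero : two_sided_ideal 0
| ideal_step a x b y : relator x -> two_sided_ideal y ->
    two_sided_ideal (a * x * b + y).

Lemma ideal_add x y :
  two_sided_ideal x -> two_sided_ideal y -> two_sided_ideal (x + y).
Proof.
elim=> [|a z b t rz _ IH] hy; first by rewrite add0r.
by rewrite -addrA; apply: ideal_step => //; apply: IH.
Qed.

Lemma ideal_mul c x d : two_sided_ideal x -> two_sided_ideal (c * x * d).
Proof.
elim=> [|a z b t rz _ IH]; first by rewrite mulr0 mul0r; constructor.
by rewrite mulrDr mulrDl !mulrA -(mulrA _ b d); apply: ideal_step.
Qed.

Lemma ideal_relator x : relator x -> two_sided_ideal x.
Proof.
move=> rx; have -> : x = 1 * x * 1 + 0 by rewrite mul1r mulr1 addr0.
exact: ideal_step rx ideal_zero.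
Qed.

Definition in_ideal : {pred A} := fun x => `[< two_sided_ideal x >].

Lemma in_ideal_zmod_closed : zmod_closed in_ideal.
Proof.
split=> [|x y /asboolP hx /asboolP hy]; apply/asboolP; first exact: ideal_zero.
apply: ideal_add => //.
by have := ideal_mul (-1) 1 hy; rewrite mulN1r mulr1.
Qed.

HB.instance Definition _ :=
  GRing.isZmodClosed.Build A in_ideal in_ideal_zmod_closed.

(* MathComp's algebras are nonzero, hence the properness argument. *)
Definition presented of ~ two_sided_ideal 1 := Quotient.quot in_ideal.

Section Quotient.
Hypothesis proper : ~ two_sided_ideal 1.
Local Notation Q := (presented proper).

HB.instance Definition _ := GRing.Zmodule.copy Q (Quotient.quot in_ideal).

Definition quot_pi (x : A) : Q := \pi_(Quotient.quot in_ideal) x.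
Definition quot_repr (x : Q) : A := repr (x : Quotient.quot in_ideal).

Lemma quot_reprK x : quot_pi (quot_repr x) = x.
Proof. exact: reprK. Qed.

Lemma quot_piP x y : quot_pi x = quot_pi y <-> two_sided_ideal (x - y).
Proof.
rewrite /quot_pi; split=> [/eqP|h].
  by rewrite -Quotient.idealrBE => /asboolP.
by apply/eqP; rewrite -Quotient.idealrBE; apply/asboolP.
Qed.

Lemma quot_piD x y : quot_pi (x + y) = quot_pi x + quot_pi y.
Proof. exact: Quotient.pi_add. Qed.

Lemma quot_piN x : quot_pi (- x) = - quot_pi x.
Proof. exact: Quotient.pi_opp. Qed.

Lemma quot_repr_pi x : two_sided_ideal (quot_repr (quot_pi x) - x).
Proof. by apply/quot_piP; rewrite quot_reprK. Qed.

Definition quot_one : Q := quot_pi 1.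
Definition quot_mul (x y : Q) : Q := quot_pi (quot_repr x * quot_repr y).
Definition quot_scale (c : K) (x : Q) : Q := quot_pi (c *: quot_repr x).

Lemma quot_piM x y : quot_pi (x * y) = quot_mul (quot_pi x) (quot_pi y).
Proof.
apply/esym/quot_piP; set x' := quot_repr _; set y' := quot_repr _.
have -> : x' * y' - x * y = (x' - x) * y' + x * (y' - y).
  by rewrite mulrBl mulrBr addrA subrK.
apply: ideal_add; last rewrite -[_ * _]mulr1; last exact/ideal_mul/quot_repr_pi.
by rewrite -[_ - _]mul1r; exact/ideal_mul/quot_repr_pi.
Qed.

Lemma quot_piZ c x : quot_pi (c *: x) = quot_scale c (quot_pi x).
Proof.
apply/esym/quot_piP; rewrite -scalerBr -mulr_algl -[_ * _]mulr1.
exact/ideal_mul/quot_repr_pi.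
Qed.

Lemma quot_mulA : associative quot_mul.
Proof.
by move=> x y z; rewrite -[x]quot_reprK -[y]quot_reprK -[z]quot_reprK
  -!quot_piM mulrA.
Qed.
Lemma quot_mul1 : left_id quot_one quot_mul.
Proof. by move=> x; rewrite -[x]quot_reprK -!quot_piM mul1r. Qed.
Lemma quot_mulr1 : right_id quot_one quot_mul.
Proof. by move=> x; rewrite -[x]quot_reprK -!quot_piM mulr1. Qed.
Lemma quot_mulDl : left_distributive quot_mul +%R.
Proof.
by move=> x y z; rewrite -[x]quot_reprK -[y]quot_reprK -[z]quot_reprK
  -quot_piD -!quot_piM mulrDl quot_piD.
Qed.
Lemma quot_mulDr : right_distributive quot_mul +%R.
Proof.
by move=> x y z; rewrite -[x]quot_reprK -[y]quot_reprK -[z]quot_reprK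
  -quot_piD -!quot_piM mulrDr quot_piD.
Qed.
Lemma quot_one_neq0 : quot_one != 0.
Proof.
apply/eqP=> h; apply: proper; rewrite -[1]subr0; apply/quot_piP.
by rewrite -/quot_one h -(subrr 1) quot_piD quot_piN subrr.
Qed.

HB.instance Definition _ := GRing.Zmodule_isNzRing.Build Q
  quot_mulA quot_mul1 quot_mulr1 quot_mulDl quot_mulDr quot_one_neq0.

Lemma quot_scaleA a b x : quot_scale a (quot_scale b x) = quot_scale (a * b) x.
Proof. by rewrite -[x]quot_reprK -!quot_piZ scalerA. Qed.
Lemma quot_scale1 : left_id 1 quot_scale.
Proof. by move=> x; rewrite -[x]quot_reprK -quot_piZ scale1r. Qed.
Lemma quot_scaleDr : right_distributive quot_scale +%R.
Proof.
by move=> c x y; rewrite -[x]quot_reprK -[y]quot_reprK -quot_piD -!quot_piZ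
  scalerDr quot_piD.
Qed.
Lemma quot_scaleDl x : {morph quot_scale^~ x : a b / a + b}.
Proof. by move=> a b; rewrite -[x]quot_reprK -!quot_piZ scalerDl quot_piD. Qed.

HB.instance Definition _ := GRing.Zmodule_isLmodule.Build K Q
  quot_scaleA quot_scale1 quot_scaleDr quot_scaleDl.

Lemma quot_mulE x y : quot_pi x * quot_pi y = quot_pi (x * y).
Proof. by rewrite quot_piM. Qed.
Lemma quot_scaleE c x : c *: quot_pi x = quot_pi (c *: x).
Proof. by rewrite quot_piZ. Qed.

Lemma quot_scaleAl (c : K) (x y : Q) : c *: (x * y) = (c *: x) * y.
Proof.
rewrite -[x]quot_reprK -[y]quot_reprK.
by rewrite !(quot_mulE, quot_scaleE) !quot_reprK scalerAl.
Qed.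

HB.instance Definition _ :=
  GRing.Lmodule_isLalgebra.Build K Q quot_scaleAl.

Lemma quot_scaleAr (c : K) (x y : Q) : c *: (x * y) = x * (c *: y).
Proof.
rewrite -[x]quot_reprK -[y]quot_reprK.
by rewrite !(quot_mulE, quot_scaleE) ?quot_reprK scalerAr.
Qed.

HB.instance Definition _ :=
  GRing.Lalgebra_isAlgebra.Build K Q quot_scaleAr.

Lemma quot_pi_zmod_morphism : zmod_morphism quot_pi.
Proof. by move=> x y; rewrite quot_piD quot_piN. Qed.

Lemma quot_pi_monoid_morphism : monoid_morphism quot_pi.
Proof. by split=> // x y; exact: quot_piM. Qed.

Lemma quot_pi_scalable : scalable quot_pi.
Proof. by move=> c x; exact: quot_piZ. Qed.

HB.instance Definition _ :=
  GRing.isZmodMorphism.Build A Q quot_pi quot_pi_zmod_morphism.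
HB.instance Definition _ :=
  GRing.isMonoidMorphism.Build A Q quot_pi quot_pi_monoid_morphism.
HB.instance Definition _ :=
  GRing.isScalable.Build K A Q *:%R quot_pi quot_pi_scalable.

End Quotient.
End PresentedAlgebra.

Section FreeAlgebra.
Variables (I : choiceType) (K : comNzRingType).

(* An alias of [{malg K[{fmonom I}]}], which the library declares an algebra   *)
(* (as opposed to a left algebra) only for commutative monoids. *)
Definition free_algebra := {malg K[{fmonom I}]}.

HB.instance Definition _ :=
  GRing.Lalgebra.copy free_algebra {malg K[{fmonom I}]}.

Lemma free_scaleAr (c : K) (x y : free_algebra) : c *: (x * y) = x * (c *: y).
Proof.
rewrite [x * y]malgME.
rewrite [RHS](malgMEw (finmap.fsubset_refl _) (msuppZ_le _ _)) scaler_sumr.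
apply: eq_bigr => k _; rewrite scaler_sumr; apply: eq_bigr => l _.
rewrite (mcoeffZ c y l) [RHS]/= mulrCA; apply/malgP => m.
by rewrite [LHS](mcoeffZ c) [in LHS]mcoeffU [RHS]mcoeffU mulrnAr.
Qed.

HB.instance Definition _ :=
  GRing.Lalgebra_isAlgebra.Build K free_algebra free_scaleAr.

Definition free_gen (i : I) : free_algebra := << fmu i >>%R.

(* The coefficient of the empty word. *)
Definition augmentation (x : free_algebra) : K^o := mcoeff (fmone I) x.

Lemma augmentation_zmod_morphism : zmod_morphism augmentation.
Proof. exact: mcoeffB. Qed.
Lemma augmentation_monoid_morphism : monoid_morphism augmentation.
Proof.
by have [? ?] := @mcoeff1g_is_multiplicative {fmonom I} K; split.
Qed.
Lemma augmentation_scalable : scalable augmentation.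
Proof. by move=> c x; exact: mcoeffZ. Qed.

HB.instance Definition _ := GRing.isZmodMorphism.Build free_algebra K^o
  augmentation augmentation_zmod_morphism.
HB.instance Definition _ := GRing.isMonoidMorphism.Build free_algebra K^o
  augmentation augmentation_monoid_morphism.

Lemma augmentation_gen i : augmentation (free_gen i) = 0.
Proof. by rewrite /augmentation mcoeffU1 /= fmuE fmoneE. Qed.

End FreeAlgebra.

(* A formal distribution in [u] is its coefficient function: [F p] is the      *)
(* coefficient of [u^p]; likewise [F p q] is the coefficient of [u^p v^q].     *)
(* Sums and scalar multiples of distributions are taken pointwise.             *)
Section Series.
Variables (K : fieldType) (B : algType K).

(* [useries c] is the sum over [r >= 0] of [c r * u^(-r)]. *)
Definition useries (c : nat -> B) : int -> B := fun p =>
  match p with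
  | Posz 0 => c 0%N
  | Posz _.+1 => 0
  | Negz r => c r.+1
  end.

(* f(-u) *)
Definition neg_arg (f : int -> B) : int -> B := fun p => (-1) ^+ `|p|%N *: f p.

(* f(u) / u *)
Definition div_u (f : int -> B) : int -> B := fun p => f (p + 1).

(* f(u) g(v) and f(v) g(u) *)
Definition at_uv (f g : int -> B) : int -> int -> B := fun p q => f p * g q.
Definition at_vu (f g : int -> B) : int -> int -> B := fun p q => f q * g p.

Definition mul_u (F : int -> int -> B) : int -> int -> B :=
  fun p q => F (p - 1) q.
Definition mul_v (F : int -> int -> B) : int -> int -> B :=
  fun p q => F p (q - 1).
Definition mul_uDv F := mul_u F + mul_v F.
Definition mul_uBv F := mul_u F - mul_v F.
Definition mul_u2Bv2 F := mul_u (mul_u F) - mul_v (mul_v F).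

(* [f(u), g(v)] *)
Definition comm_uv (f g : int -> B) : int -> int -> B := at_uv f g - at_vu g f.

End Series.

(* [SO m] stands for so_N with N = m+1, and [SP m] for sp_N with N = 2(m+1):   *)
(* N has to be a successor for 'I_N to carry the additive group Z_N. *)
Inductive twisted_type := SO of nat | SP of nat.

Definition pred_dim (g : twisted_type) : nat :=
  match g with SO m => m | SP m => m.*2.+1 end.

Notation dim g := (pred_dim g).+1.
Notation idx g := 'I_(dim g).

Section TwistedYangian.
Variables (R : realType) (g : twisted_type).
Local Notation C := R[i].
Local Notation N := (dim g).
Local Notation I := (idx g).

Definition theta (i : I) : C :=
  match g with SO _ => 1 | SP m => if (i < m.+1)%N then -1 else 1 end.

Definition pm_sign : C := match g with SO _ => 1 | SP _ => -1 end.

Definition omega : C :=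
  Complex (cos (2 * pi / N%:R)) (sin (2 * pi / N%:R)).

Section Relations.
Variable B : algType C.

(* Families of generators are indexed from 0: [s i j r] is s_{ij}^{(r+1)}. *)
Variable s : I -> I -> nat -> B.

(* s_{ij}^{(r)}, including s_{ij}^{(0)} *)
Definition s_coef (i j : I) (r : nat) : B :=
  if r is r'.+1 then s i j r' else (i == j)%:R.

Local Notation S i j := (useries (s_coef i j)).
Local Notation pr i := (rev_ord i).

Definition quaternary_lhs (i j k l : I) : int -> int -> B :=
  mul_u2Bv2 (comm_uv (S i j) (S k l)).

Definition quaternary_rhs (i j k l : I) : int -> int -> B :=
  mul_uDv (at_uv (S k j) (S i l) - at_vu (S k j) (S i l))
  - mul_uBv ((theta k * theta (pr j)) *: at_uv (S i (pr k)) (S (pr j) l)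
             - (theta i * theta (pr l)) *: at_vu (S k (pr i)) (S (pr l) j))
  + (theta i * theta (pr j)) *:
      (at_uv (S k (pr i)) (S (pr j) l) - at_vu (S k (pr i)) (S (pr j) l)).

Definition symmetry_lhs (i j : I) : int -> B :=
  (theta i * theta j) *: neg_arg (S (pr j) (pr i)).

Definition symmetry_rhs (i j : I) : int -> B :=
  S i j + pm_sign *: (2^-1 *: div_u (S i j - neg_arg (S i j))).

Definition twisted_relations : Prop :=
  (forall i j k l, quaternary_lhs i j k l = quaternary_rhs i j k l) /\
  (forall i j, symmetry_lhs i j = symmetry_rhs i j).

End Relations.

Local Notation free := (free_algebra (I * I * nat)%type C).

Definition free_s (i j : I) (r : nat) : free := free_gen C (i, j, r).

Inductive twisted_relator : free -> Prop :=
| quaternary_relator i j k l p q : twisted_relator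
    (quaternary_lhs free_s i j k l p q - quaternary_rhs free_s i j k l p q)
| symmetry_relator i j p : twisted_relator
    (symmetry_lhs free_s i j p - symmetry_rhs free_s i j p).

End TwistedYangian.

Section Naturality.
Variables (R : realType) (g : twisted_type) (B B' : algType R[i]).
Variables (f : {rmorphism B -> B'}).
Hypothesis fZ : scalable f.
Variable s : idx g -> idx g -> nat -> B.
Let s' i j r := f (s i j r).

Lemma useries_nat i j p :
  f (useries (s_coef s i j) p) = useries (s_coef s' i j) p.
Proof.
case: p => [[|p]|p] /=; rewrite ?raddf0 //.
by rewrite rmorph_nat.
Qed.

Lemma quaternary_lhs_nat i j k l p q :
  f (quaternary_lhs s i j k l p q) = quaternary_lhs s' i j k l p q.
Proof.
rewrite /quaternary_lhs /mul_u2Bv2 /mul_u /mul_v /comm_uv /at_uv /at_vu.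
rewrite !(addrfctE, opprfctE).
by rewrite !(rmorphB, rmorphM) !useries_nat.
Qed.

Lemma quaternary_rhs_nat i j k l p q :
  f (quaternary_rhs s i j k l p q) = quaternary_rhs s' i j k l p q.
Proof.
rewrite /quaternary_rhs /mul_uDv /mul_uBv /mul_u /mul_v /at_uv /at_vu.
rewrite !(addrfctE, opprfctE, scalrfctE).
by rewrite !(rmorphB, rmorphD, fZ, rmorphM) !useries_nat.
Qed.

Lemma symmetry_lhs_nat i j p :
  f (symmetry_lhs s i j p) = symmetry_lhs s' i j p.
Proof.
by rewrite /symmetry_lhs /neg_arg !scalrfctE !fZ useries_nat.
Qed.

Lemma symmetry_rhs_nat i j p :
  f (symmetry_rhs s i j p) = symmetry_rhs s' i j p.
Proof.
rewrite /symmetry_rhs /neg_arg /div_u !(addrfctE, opprfctE, scalrfctE).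
by rewrite !(rmorphD, rmorphN, fZ) !useries_nat.
Qed.

End Naturality.

Section Properness.
Variables (R : realType) (g : twisted_type).
Local Notation C := R[i].
Local Notation I := (idx g).

Lemma theta_sqr (i : I) : theta R i * theta R i = 1.
Proof.
rewrite /theta; case: g i => m i; first by rewrite mulr1.
by case: ifP => _; rewrite ?mulrNN mulr1.
Qed.

Lemma theta_rev (i j : I) :
  theta R (rev_ord i) * theta R (rev_ord j) = theta R i * theta R j.
Proof.
rewrite /theta; case: g i j => m i j //=.
have rev_lt (k : 'I_(m.*2.+2)) : (m.*2.+2 - k.+1 < m.+1)%N = ~~ (k < m.+1)%N.
  move: (k : nat) => {}k.
  by rewrite -leqNgt ltnS leq_subLR -addnn addSn ltnS -addSn leq_add2r.
by rewrite !rev_lt; case: (i < _)%N; case: (j < _)%N;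
  rewrite /= ?mulrNN ?mulr1 ?mul1r.
Qed.

Let z (i j : I) (r : nat) : C^o := 0.

Lemma trivial_series (i j : I) p :
  useries (s_coef z i j) p = ((i == j) && (p == 0))%:R.
Proof. by case: p => [[|p]|p] /=; rewrite ?andbT ?andbF. Qed.

Lemma trivial_quaternary i j k l p q :
  quaternary_lhs z i j k l p q = quaternary_rhs z i j k l p q.
Proof.
have at_vuE i1 j1 i2 j2 : at_vu (useries (s_coef z i1 j1)) (useries (s_coef z i2 j2))
  = at_uv (useries (s_coef z i1 j1)) (useries (s_coef z i2 j2)).
  apply/funext => a; apply/funext => b; rewrite /at_uv /at_vu !trivial_series.
  rewrite -!natrM !mulnb; congr (_%:R).
  by do 4 case: (_ == _).
have at_uvC f h : at_uv f h = at_vu h f :> (int -> int -> C^o).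
  by apply/funext => a; apply/funext => b; rewrite /at_uv /at_vu; exact: mulrC.
rewrite /quaternary_lhs /quaternary_rhs /comm_uv !at_vuE.
have -> : at_uv (useries (s_coef z i j)) (useries (s_coef z k l)) =
          at_uv (useries (s_coef z k l)) (useries (s_coef z i j)).
  by rewrite at_uvC at_vuE.
rewrite !subrr scaler0 addr0 /mul_u2Bv2 /mul_uDv /mul_uBv /mul_u /mul_v.
rewrite !(addrfctE, opprfctE, scalrfctE) !addr0 !subr0 add0r.
have E p' q' : (theta R k * theta R (rev_ord j)) *:
     at_uv (useries (s_coef z i (rev_ord k))) (useries (s_coef z (rev_ord j) l)) p' q' =
   (theta R i * theta R (rev_ord l)) *:
     at_uv (useries (s_coef z k (rev_ord i))) (useries (s_coef z (rev_ord l) j)) p' q'.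
  rewrite /at_uv !trivial_series.
  have -> : (k == rev_ord i) = (i == rev_ord k).
    by rewrite -(inj_eq rev_ord_inj) rev_ordK eq_sym.
  have -> : (rev_ord l == j) = (rev_ord j == l).
    by rewrite -(inj_eq rev_ord_inj) rev_ordK eq_sym.
  case: (i =P rev_ord k) => [->|_]; last by rewrite !mul0r !scaler0.
  case: (rev_ord j =P l) => [<-|_]; last by rewrite !mulr0 !scaler0.
  by rewrite rev_ordK -(theta_rev _ j) rev_ordK.
by rewrite !E !subrr; apply/esym; exact: oppr0.
Qed.

Lemma trivial_symmetry i j p : symmetry_lhs z i j p = symmetry_rhs z i j p.
Proof.
rewrite /symmetry_lhs /symmetry_rhs /neg_arg /div_u.
rewrite !(addrfctE, opprfctE, scalrfctE) !trivial_series.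
have -> : (rev_ord j == rev_ord i) = (i == j).
  by rewrite (inj_eq rev_ord_inj) eq_sym.
have N0 (b : bool) (p' : int) :
  (-1) ^+ `|p'|%N *: (b && (p' == 0))%:R = (b && (p' == 0))%:R :> C^o.
  by have [->|_] := eqVneq p' 0; rewrite ?expr0 ?scale1r // andbF scaler0.
rewrite !N0 subrr !scaler0 addr0.
by have [->|_] := eqVneq i j; rewrite ?theta_sqr ?scale1r //= scaler0.
Qed.

Lemma augmentation_ideal x :
  two_sided_ideal (@twisted_relator R g) x -> augmentation x = 0.
Proof.
have fZ := @augmentation_scalable (I * I * nat)%type C.
have s0 : (fun i j r => augmentation (free_s R i j r)) = z.
  by apply/funext => i; apply/funext => j; apply/funext => r; exact: augmentation_gen.
elim=> [|a y b t ry _ IH]; first exact: raddf0.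
rewrite rmorphD /= IH addr0 !rmorphM /=; suff -> : augmentation y = 0.
  by rewrite mulr0 mul0r.
case: y / ry => [i j k l p q|i j p]; rewrite rmorphB.
  rewrite [X in X - _](quaternary_lhs_nat (@augmentation (I * I * nat)%type C) (@free_s R g)).
  rewrite [X in _ - X](quaternary_rhs_nat fZ (@free_s R g)) s0.
  by rewrite trivial_quaternary subrr.
rewrite [X in X - _](symmetry_lhs_nat fZ (@free_s R g)).
by rewrite [X in _ - X](symmetry_rhs_nat fZ (@free_s R g)) s0 trivial_symmetry subrr.
Qed.

Lemma twisted_proper : ~ two_sided_ideal (@twisted_relator R g) 1.
Proof. by move/augmentation_ideal/eqP; rewrite rmorph1 oner_eq0. Qed.

End Properness.

Definition twisted_yangian (R : realType) (g : twisted_type) : algType R[i] :=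
  presented (@twisted_proper R g).

Definition twisted_s (R : realType) (g : twisted_type) (i j : idx g) (r : nat) :
  twisted_yangian R g := quot_pi (@twisted_proper R g) (free_s R i j r).

Lemma twisted_sP (R : realType) (g : twisted_type) :
  twisted_relations (@twisted_s R g).
Proof.
have fZ := quot_pi_scalable (@twisted_proper R g).
split=> [i j k l|i j].
  apply/funext => p; apply/funext => q.
  transitivity (quot_pi (@twisted_proper R g) (quaternary_lhs (@free_s R g) i j k l p q)).
    exact/esym/(quaternary_lhs_nat (quot_pi (@twisted_proper R g))).
  transitivity (quot_pi (@twisted_proper R g) (quaternary_rhs (@free_s R g) i j k l p q)).
    apply: (proj2 (quot_piP (@twisted_proper R g) _ _)); apply: ideal_relator.
    exact: quaternary_relator.
  exact: (quaternary_rhs_nat fZ).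
apply/funext => p.
transitivity (quot_pi (@twisted_proper R g) (symmetry_lhs (@free_s R g) i j p)).
  exact/esym/(symmetry_lhs_nat fZ).
transitivity (quot_pi (@twisted_proper R g) (symmetry_rhs (@free_s R g) i j p)).
  apply: (proj2 (quot_piP (@twisted_proper R g) _ _)); apply: ideal_relator.
  exact: symmetry_relator.
exact: (symmetry_rhs_nat fZ).
Qed.

Section PrincipalGenerators.
Variables (R : realType) (g : twisted_type).
Local Notation C := R[i].
Local Notation N := (dim g).
Local Notation I := (idx g).
Local Notation omega := (omega R g).
Local Notation theta := (theta R).

(* Index sums such as [m + l] are taken in the additive group Z_N. *)
Definition Amx (k l : I) : 'M[C]_N :=
  \sum_(m : I) omega ^+ (m * k)%N *: delta_mx m (m + l).

Section Relations.
Variable B : algType C.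

(* B (x) End C^N is identified with 'M[B]_N. *)
Definition tens (b : B) (M : 'M[C]_N) : 'M[B]_N := map_mx (fun c => c *: b) M.

Definition S_coef (s : I -> I -> nat -> B) (r : nat) : 'M[B]_N :=
  \matrix_(i, j) s_coef s i j r.

(* [y] is indexed from 0: [y k l r] is y_{kl}^{(r)}. *)
Definition principal_generators (s y : I -> I -> nat -> B) : Prop :=
  forall r, S_coef s r = \sum_(k : I) \sum_(l : I) tens (y k l r) (Amx k l).

Variable y : I -> I -> nat -> B.
Local Notation Y i j := (useries (y i j)).
Local Notation "i %:z" := (Posz (nat_of_ord i)) (at level 2, format "i %:z").
Local Notation w e := (omega ^ e).

(* The A_ij (x) A_kl component of the quaternary relation. The operator Q      *)
(* enters R^t(-u-v) as 1 + Q/(u+v), which is the origin of the minus sign on   *)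
(* the y(u)y(v) part of the (u-v) terms. *)
Definition principal_quaternary (i j k l : I) : Prop :=
  mul_u2Bv2 (comm_uv (Y i j) (Y k l)) =
    N%:R^-1 *: mul_uDv (\sum_(a : I) \sum_(b : I)
      (w (b%:z * (i%:z - k%:z - a%:z))
         *: at_uv (Y (i - a) (j - b)) (Y (k + a) (l + b))
       - w (a%:z * (j%:z - l%:z - b%:z))
         *: at_vu (Y (k + a) (l + b)) (Y (i - a) (j - b))))
  - (N%:R ^+ 2)^-1 *: mul_uBv
      (\sum_(a : I) \sum_(b : I) \sum_(a' : I) \sum_(b' : I)
        (theta a' * theta (a' + b)
          * w (- a%:z - a'%:z * (a%:z + b'%:z) + b'%:z * (j%:z - b%:z)
               - b%:z * (k%:z + a%:z)))
        *: at_uv (Y (i - b') (j - b)) (Y (k + a) (l + b)))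
  + (N%:R ^+ 2)^-1 *: mul_uBv
      (\sum_(a : I) \sum_(b : I) \sum_(a' : I) \sum_(b' : I)
        (theta a' * theta (a' + b)
          * w (- a%:z - a'%:z * (a%:z + b'%:z) + b%:z * (i%:z - b'%:z)
               - a%:z * (l%:z + b%:z)))
        *: at_vu (Y (k + a) (l + b)) (Y (i - b') (j - b)))
  + (N%:R ^+ 3)^-1 *:
      (\sum_(a : I) \sum_(b : I) \sum_(a' : I) \sum_(b' : I)
       \sum_(c : I) \sum_(d : I)
        (theta a' * theta (a' + b)
          * w (- a%:z - a'%:z * (a%:z + b'%:z)
               + b'%:z * (j%:z - b%:z - d%:z)
               - b%:z * (k%:z + a%:z + c%:z) + d%:z * (i%:z - k%:z - c%:z)))
        *: at_uv (Y (i - c - b') (j - d - b)) (Y (k + a + c) (l + b + d)))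
  - (N%:R ^+ 3)^-1 *:
      (\sum_(a : I) \sum_(b : I) \sum_(a' : I) \sum_(b' : I)
       \sum_(c : I) \sum_(d : I)
        (theta a' * theta (a' + b)
          * w (- a%:z - a'%:z * (a%:z + b'%:z)
               + b%:z * (i%:z - c%:z - b'%:z)
               - a%:z * (l%:z + b%:z + d%:z) + c%:z * (j%:z - l%:z - d%:z)))
        *: at_vu (Y (k + a + c) (l + b + d)) (Y (i - c - b') (j - d - b))).

Definition principal_symmetry (i j : I) : Prop :=
  N%:R^-1 *: (\sum_(k : I) \sum_(l : I)
    (theta k * theta (k + j)
      * w (- l%:z * (1 + j%:z) - k%:z * (i%:z + l%:z)))
    *: neg_arg (Y l j)) =
  Y i j + pm_sign R g *: (2^-1 *: div_u (Y i j - neg_arg (Y i j))).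

Definition principal_relations : Prop :=
  (forall i j k l, principal_quaternary i j k l) /\
  (forall i j, principal_symmetry i j).

Definition so_quaternary (i j k l : I) : Prop :=
  mul_u2Bv2 (comm_uv (Y i j) (Y k l)) =
    N%:R^-1 *: mul_uDv (\sum_(a : I) \sum_(b : I)
      (w (b%:z * (i%:z - k%:z - a%:z))
         *: at_uv (Y (i - a) (j - b)) (Y (k + a) (l + b))
       - w (a%:z * (j%:z - l%:z - b%:z))
         *: at_vu (Y (k + a) (l + b)) (Y (i - a) (j - b))))
  + N%:R^-1 *: mul_uBv (\sum_(a : I) \sum_(b : I)
      (w (- a%:z + b%:z * i%:z - l%:z * a%:z)
         *: at_vu (Y (k + a) (l + b)) (Y (i + a) (j - b))
       - w (- a%:z - a%:z * j%:z - b%:z * k%:z)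
         *: at_uv (Y (i + a) (j - b)) (Y (k + a) (l + b))))
  + (N%:R ^+ 2)^-1 *:
      (\sum_(a : I) \sum_(b : I) \sum_(a' : I) \sum_(b' : I)
        w (- a%:z - a%:z * j%:z + b'%:z * (a%:z - k%:z + i%:z - a'%:z)
           - b%:z * (k%:z + a'%:z))
        *: at_uv (Y (i + a - a') (j - b - b')) (Y (k + a + a') (l + b + b')))
  - (N%:R ^+ 2)^-1 *:
      (\sum_(a : I) \sum_(b : I) \sum_(a' : I) \sum_(b' : I)
        w (- a%:z + b%:z * i%:z + a'%:z * (j%:z - b%:z - b'%:z - l%:z)
           - a%:z * (l%:z + b'%:z))
        *: at_vu (Y (k + a + a') (l + b + b')) (Y (i + a - a') (j - b - b'))).

Definition so_symmetry (i j : I) : Prop :=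
  w (i%:z * (1 + j%:z)) *: neg_arg (Y (- i) j) =
  Y i j + 2^-1 *: div_u (Y i j - neg_arg (Y i j)).

Definition so_relations : Prop :=
  (forall i j k l, so_quaternary i j k l) /\ (forall i j, so_symmetry i j).

End Relations.
End PrincipalGenerators.

Section PrincipalGeneratorsExist.
Variables (R : realType) (g : twisted_type).
Local Notation C := R[i].
Local Notation N := (dim g).
Local Notation I := (idx g).
Local Notation omega := (omega R g).

Lemma omegaX k : omega ^+ k =
  Complex (cos (2 * pi / N%:R * k%:R)) (sin (2 * pi / N%:R * k%:R)).
Proof.
elim: k => [|k IH]; first by rewrite mulr0 cos0 sin0.
rewrite exprSr {}IH /Defs.omega; set x := 2 * pi / _; rewrite -natr1.
rewrite [x * (_ + 1)]mulrDr mulr1 cosD sinD.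
by rewrite [sin _ * cos _ + _]addrC.
Qed.

Lemma omega_prim : N.-primitive_root omega.
Proof.
have N_neq0 : N%:R != 0 :> R by rewrite pnatr_eq0.
rewrite /primitive_root_of_unity /=; apply/forallP => k; apply/eqP.
rewrite unity_rootE omegaX; case: (eqVneq k.+1 N) => [->|kN].
  by rewrite divfK // mulr_natl cos2pi sin2pi eqxx.
apply/negbTE/eqP => -[+ _]; pose x : R := pi / N%:R * k.+1%:R.
have -> : 2 * pi / N%:R * k.+1%:R = x *+ 2.
  by rewrite -[RHS]mulr_natl /x !mulrA.
rewrite cos_mulr2n cos2sin2 => h0.
have kN' : (k.+1 < N)%N by rewrite ltn_neqAle kN /=.
have : 0 < sin x.
  apply: sin_gt0_pi; rewrite /x; apply/andP; split.
    by rewrite mulr_gt0 ?divr_gt0 ?pi_gt0 ?ltr0n.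
  by rewrite -mulrA gtr_pMr ?pi_gt0 // mulrC ltr_pdivrMr ?ltr0n // mul1r ltr_nat.
move=> s0; have : sin x ^+ 2 = 0 by lra.
by move/eqP; rewrite sqrf_eq0 gt_eqF.
Qed.

Lemma sum_omega (m m' : I) :
  \sum_(k : I) omega ^+ (m * k)%N * (omega ^+ (m' * k)%N)^-1 =
  if m == m' then N%:R else 0.
Proof.
have w0 : omega != 0.
  by apply/eqP=> h; have /eqP := prim_expr_order omega_prim; rewrite h expr0n /= eq_sym oner_eq0.
set z := omega ^+ m / omega ^+ m'.
have -> : \sum_(k : I) omega ^+ (m * k)%N * (omega ^+ (m' * k)%N)^-1 =
          \sum_(k : I) z ^+ k.
  by apply: eq_bigr => k _; rewrite !exprM exprMn exprVn.
case: (eqVneq m m') => [mm|mm].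
  rewrite (eq_bigr (fun=> 1)) => [|k _].
    by rewrite sumr_const card_ord.
  by rewrite /z mm divff ?expf_neq0 // expr1n.
have zN : z ^+ N = 1.
  by rewrite /z exprMn exprVn -!exprM ![(_ * N)%N]mulnC !exprM
    (prim_expr_order omega_prim) !expr1n invr1 mulr1.
have z1 : z != 1.
  apply: contra mm => /eqP h; have : omega ^+ m = omega ^+ m'.
    by rewrite -[RHS]mul1r -h /z divfK ?expf_neq0.
  move/eqP; rewrite (eq_prim_root_expr omega_prim) !modn_small ?ltn_ord //.
have := subrX1 z N; rewrite zN subrr => /esym/eqP.
by rewrite mulf_eq0 subr_eq0 (negbTE z1) => /eqP.
Qed.

Lemma AmxE (k l i j : I) :
  Amx R k l i j = if l == j - i then omega ^+ (i * k)%N else 0.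
Proof.
rewrite summxE (bigD1 i) //= big1 => [|m mi]; last first.
  by rewrite !mxE [i == m]eq_sym (negbTE mi) mulr0.
rewrite !mxE eqxx addr0 [l == _]eq_sym subr_eq addrC.
by case: eqP; rewrite ?mulr1 ?mulr0.
Qed.

Variable B : algType C.

Lemma sum_tens_Amx (f : I -> I -> B) (i j : I) :
  (\sum_(k : I) \sum_(l : I) tens (f k l) (Amx R k l)) i j =
  \sum_(k : I) omega ^+ (i * k)%N *: f k (j - i).
Proof.
rewrite summxE; apply: eq_bigr => k _; rewrite summxE (bigD1 (j - i)) //=.
rewrite big1 => [|l lij]; rewrite mxE AmxE; first by rewrite eqxx addr0.
by rewrite (negbTE lij) scale0r.
Qed.

Lemma principal_generators_exist (s : I -> I -> nat -> B) :
  exists y, principal_generators s y.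
Proof.
exists (fun k l r => N%:R^-1 *:
  \sum_(m : I) (omega ^+ (m * k)%N)^-1 *: s_coef s m (m + l) r) => r.
apply/matrixP => i j; rewrite sum_tens_Amx mxE; apply/esym.
under eq_bigr => k _ do rewrite scalerA mulrC -scalerA scaler_sumr.
rewrite -scaler_sumr exchange_big /=.
under eq_bigr => m _.
  under eq_bigr => k _ do rewrite scalerA.
  rewrite -scaler_suml sum_omega.
  over.
rewrite (bigD1 i) //= eqxx big1 => [|m mi].
  by rewrite addr0 scalerA mulVf ?pnatr_eq0 // scale1r addrC subrK.
by rewrite eq_sym (negbTE mi) scale0r.
Qed.

Lemma principal_generators_uniq (s y y' : I -> I -> nat -> B) :
  principal_generators s y -> principal_generators s y' ->
  forall k l r, y k l r = y' k l r.
Proof.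
have inv y0 : principal_generators s y0 -> forall k l r,
    y0 k l r = N%:R^-1 *:
      \sum_(m : I) (omega ^+ (m * k)%N)^-1 *: s_coef s m (m + l) r.
  move=> hy k l r; apply/esym.
  have hs m : s_coef s m (m + l) r =
      \sum_(k' : I) omega ^+ (m * k')%N *: y0 k' l r.
    have := congr1 (fun M : 'M_N => M m (m + l)) (hy r).
    by rewrite sum_tens_Amx mxE addrAC subrr add0r.
  under eq_bigr => m _ do rewrite hs scaler_sumr.
  rewrite exchange_big /= (bigD1 k) //= [X in _ + X]big1 => [|k' kk].
    rewrite addr0; under eq_bigr => m _ do rewrite scalerA mulrC ![(m * _)%N]mulnC.
    by rewrite -scaler_suml sum_omega eqxx scalerA mulVf ?pnatr_eq0 // scale1r.
  under eq_bigr => m _ do rewrite scalerA mulrC ![(m * _)%N]mulnC.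
  by rewrite -scaler_suml sum_omega (negbTE kk) scale0r.
by move=> /inv hy /inv hy' k l r; rewrite hy hy'.
Qed.

End PrincipalGeneratorsExist.

(* Main.v *)
Require Import Defs.
From HB Require Import structures.
From mathcomp Require Import all_boot all_order all_algebra.
From mathcomp Require Import ring.
From mathcomp Require Import boolp functions reals complex.

Set Implicit Arguments.
Unset Strict Implicit.
Unset Printing Implicit Defensive.

Import GRing.Theory Num.Theory.
Local Open Scope ring_scope.

(** The matrices A_kl are obtained from the matrix units by a discrete Fourier
    transform along the diagonals: s_(p,q)(u) is the sum over k of
    w^(pk) y_(k,q-p)(u), where w is the primitive N-th root of unity, and the
    orthogonality of characters inverts this formula. Hence a relation between
    the entries of tensors M = (M_(pq,rt)), such as S(u) (x) S(v), holds for
    all indices if and only if its Fourier transform does, and the theorem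
    amounts to computing the transform of the two sides of the defining
    relations.

    The right-hand side of the quaternary relation is made of four operations
    on tensors: multiplication by the permutation operator P, on the left or on
    the right, and the products S_1 Q S_2 and S_2 Q S_1. Each of them only
    permutes entries, up to signs theta, and is computed once
    (coordinates_swap_left, coordinates_swap_right, coordinates_contract_left,
    coordinates_contract_right). The terms P S_1 Q S_2 and S_2 Q S_1 P
    are compositions of two operations, so their sixfold sums come from
    nesting a double sum and a fourfold sum. This gives twisted_relationsE: a
    family s satisfies the twisted relations if and only if its principal
    generators satisfy the principal relations, in any algebra.

    In the orthogonal case theta = 1, so the summation index a' occurs only in
    the character; summing over it kills all terms but those with b' = - a,
    and the principal relations collapse to the reduced ones (so_relationsE).

    The Fourier part is done over an arbitrary finite commutative ring A with
    a nondegenerate character. This turns every comparison of exponents and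
    indices into a ring identity in A, where A = Z/N at the end. *)

(** * Fourier transform over a finite commutative ring *)

(** Orthogonality is required of the pairing (p, x) |-> chi (p * x): this is
    what makes the transform invertible. *)
Definition nondegenerate_character (A : finComPzRingType) (K : fieldType)
    (chi : A -> K) : Prop :=
  (forall x y, chi (x + y) = chi x * chi y) /\
  (forall x, \sum_p chi (p * x) = #|A|%:R *+ (x == 0)).

Section Reindexing.
Variables (A : finZmodType) (V : nmodType).

Lemma sum_shift (c : A) (F : A -> V) : \sum_x F x = \sum_x F (c + x).
Proof. by rewrite (reindex_inj (addrI c)). Qed.

Lemma sum_reflect (c : A) (F : A -> V) : \sum_x F x = \sum_x F (c - x).
Proof.
by rewrite (reindex_inj (can_inj (subKr c))).
Qed.

End Reindexing.

Lemma scaler_swap (K : comPzRingType) (V : lmodType K) (a b : K) (v : V) :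
  a *: (b *: v) = b *: (a *: v).
Proof. by rewrite !scalerA mulrC. Qed.

Section Fourier.
Variables (A : finComPzRingType) (K : fieldType) (chi : A -> K).
Hypotheses (chiP : nondegenerate_character chi) (N_neq0 : #|A|%:R != 0 :> K).
Local Notation N := (#|A|%:R : K).

Let chiD x y : chi (x + y) = chi x * chi y. Proof. by case: chiP. Qed.

Lemma scale_chi (V : lmodType K) x y (v : V) :
  chi x *: (chi y *: v) = chi (x + y) *: v.
Proof. by rewrite scalerA chiD. Qed.

(** Fourier inversion in the form used below: a sum over a character whose
    argument contains b - c freezes the index b to c. *)
Lemma sum_chi (V : lmodType K) (c : A) (F : A -> V) :
  \sum_b \sum_a chi (a * (b - c)) *: F b = N *: F c.
Proof.
case: chiP => _ chiS.
under eq_bigr => b _ do rewrite -scaler_suml chiS subr_eq0.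
rewrite (bigD1 c) //= eqxx big1 ?addr0 // => b bc.
by rewrite (negbTE bc) scale0r.
Qed.

Section Coordinates.
Variable V : lmodType K.

(** Coordinates on the matrices A_ij of a matrix given by its entries; the
    diagonal index j is left untouched by the transform. *)
Definition coordinates (M : A -> A -> V) (i j : A) : V :=
  N^-1 *: \sum_p chi (- (p * i)) *: M p (p + j).

Definition entries (X : A -> A -> V) (p q : A) : V :=
  \sum_i chi (p * i) *: X i (q - p).

Lemma entriesK : cancel entries coordinates.
Proof.
move=> X; apply/funext => i; apply/funext => j; rewrite /coordinates /entries.
apply: (scalerI N_neq0); rewrite scalerA divff // scale1r.
rewrite -(sum_chi i (X^~ j)) exchange_big /=; apply: eq_bigr => p _.
rewrite scaler_sumr; apply: eq_bigr => x _; rewrite scale_chi.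
by congr (chi _ *: X _ _); ring.
Qed.

Lemma coordinatesK : cancel coordinates entries.
Proof.
move=> M; apply/funext => p; apply/funext => q; rewrite /coordinates /entries.
apply: (scalerI N_neq0); rewrite -[in RHS](subrK p q) [_ - _ + p]addrC.
rewrite -(sum_chi p (fun r => M r (r + (q - p)))) exchange_big /=.
rewrite (sum_reflect 0) scaler_sumr; apply: eq_bigr => i _.
rewrite scaler_swap [N *: _]scalerA divff // scale1r scaler_sumr.
apply: eq_bigr => r _; rewrite scale_chi.
by congr (chi _ *: _); ring.
Qed.

End Coordinates.

Lemma coordinates_linear (V W : lmodType K) (f : V -> W) M i j :
  linear f -> coordinates (fun p q => f (M p q)) i j = f (coordinates M i j).
Proof.
move=> f_lin; pose L : {linear V -> W} :=
  HB.pack f (GRing.isLinear.Build K V W *:%R f f_lin).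
rewrite /coordinates -![f _]/(L _) linearZZ; congr (_ *: _); rewrite linear_sum.
by apply: eq_bigr => p _; rewrite linearZZ.
Qed.

Section Coordinates2.
Variable V : lmodType K.
Implicit Types M X : A -> A -> A -> A -> V.

(** A four-index family stands for an element of End (x) End, with the first
    two indices in the first factor. *)
Definition coordinates2 M (i j k l : A) : V :=
  coordinates (fun p q => coordinates (M p q) k l) i j.

Definition entries2 X (p q r t : A) : V :=
  entries (fun z w => entries (fun x y => X x y z w) p q) r t.

Lemma entries2K : cancel entries2 coordinates2.
Proof.
move=> X; apply/funext => i; apply/funext => j; apply/funext => k.
apply/funext => l; rewrite /coordinates2 /entries2.
transitivity (coordinates (entries (fun x y => X x y k l)) i j).
  by congr (coordinates _ i j); apply/funext => p; apply/funext => q;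
    rewrite entriesK.
by rewrite entriesK.
Qed.

Lemma coordinates2K : cancel coordinates2 entries2.
Proof.
move=> M; apply/funext => p; apply/funext => q; apply/funext => r.
apply/funext => t; rewrite /coordinates2 /entries2.
transitivity (entries (coordinates (M p q)) r t).
  by congr (entries _ r t); apply/funext => z; apply/funext => w;
    rewrite coordinatesK.
by rewrite coordinatesK.
Qed.

Lemma coordinates2E M i j k l : coordinates2 M i j k l =
  (N ^+ 2)^-1 *: \sum_p \sum_r chi (- (p * i) - r * k) *: M p (p + j) r (r + l).
Proof.
rewrite /coordinates2 /coordinates expr2 invfM -scalerA; congr (_ *: _).
rewrite scaler_sumr; apply: eq_bigr => p _.
rewrite scaler_swap; congr (_ *: _); rewrite scaler_sumr.
by apply: eq_bigr => r _; rewrite scale_chi.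
Qed.

Lemma entries2E X p q r t : entries2 X p q r t =
  \sum_x \sum_z chi (p * x + r * z) *: X x (q - p) z (t - r).
Proof.
rewrite /entries2 /entries exchange_big; apply: eq_bigr => z _ /=.
rewrite scaler_sumr; apply: eq_bigr => x _.
by rewrite scale_chi addrC.
Qed.

(** * Operators P and Q in the coordinates of the tensor square *)
Variable theta : A -> K.
(* The matrix index i' = N - 1 - i is - 1 - i in Z/N. *)
Hypothesis theta_opp : forall x y,
  theta (- 1 - x) * theta (- 1 - y) = theta x * theta y.

(** Left and right multiplication by P, in coordinates: see
    coordinates_swap_left and coordinates_swap_right. *)
Definition swap_left X i j k l : V :=
  N^-1 *: \sum_a \sum_b
    chi (b * (i - k - a)) *: X (i - a) (j - b) (k + a) (l + b).

Definition swap_right X i j k l : V :=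
  N^-1 *: \sum_a \sum_b
    chi (a * (j - l - b)) *: X (i - a) (j - b) (k + a) (l + b).

(** The insertions of Q, as in S_1 Q S_2 and S_2 Q S_1: see
    coordinates_contract_left and coordinates_contract_right. *)
Definition contract_left X i j k l : V :=
  (N ^+ 2)^-1 *: \sum_a \sum_b \sum_a' \sum_b'
    (theta a' * theta (a' + b)
      * chi (- a - a' * (a + b') + b' * (j - b) - b * (k + a)))
      *: X (i - b') (j - b) (k + a) (l + b).

Definition contract_right X i j k l : V :=
  (N ^+ 2)^-1 *: \sum_a \sum_b \sum_a' \sum_b'
    (theta a' * theta (a' + b)
      * chi (- a - a' * (a + b') + b * (i - b') - a * (l + b)))
      *: X (i - b') (j - b) (k + a) (l + b).

(** Multiplying by P on the left exchanges the row indices p and r of the two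
    factors. After the substitution r = p + b the index p occurs only in the
    character, so the sum over p forces the two character indices x and z to
    have the sum i + k; this leaves the parameters a and b. *)
Lemma coordinates_swap_left M i j k l :
  coordinates2 (fun p q r t => M r q p t) i j k l =
  swap_left (coordinates2 M) i j k l.
Proof.
rewrite -[M in LHS]coordinates2K; set X := coordinates2 M.
rewrite /swap_left coordinates2E expr2 invfM -scalerA; congr (_ *: _).
apply: (scalerI N_neq0); rewrite scalerA divff // scale1r.
rewrite [in RHS]exchange_big scaler_sumr /=.
under eq_bigr => p _ do rewrite (sum_shift p).
rewrite exchange_big; apply: eq_bigr => b _ /=.
(* Here x = i - a; the sum over p then gives z = k + a. *)
rewrite [in RHS](sum_reflect i) scaler_sumr.
transitivity (\sum_x \sum_z \sum_p chi (p * (z - (i + k - x))) *: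
    (chi (b * (x - k)) *: X x (j - b) z (l + b))).
  rewrite [in RHS](eq_bigr _ (fun x _ => exchange_big _ _ _ _ _ _)) /=.
  rewrite [in RHS]exchange_big; apply: eq_bigr => p _ /=.
  rewrite entries2E scaler_sumr; apply: eq_bigr => x _.
  rewrite scaler_sumr; apply: eq_bigr => z _; rewrite !scale_chi.
  by congr (chi _ *: X _ _ _ _); ring.
apply: eq_bigr => x _; rewrite sum_chi; congr (_ *: _).
by congr (chi _ *: X _ _ _ _); ring.
Qed.

(** Multiplying by P on the right exchanges the column indices. The argument
    is that of coordinates_swap_left, with r = p + j - l - b. *)
Lemma coordinates_swap_right M i j k l :
  coordinates2 (fun p q r t => M p t r q) i j k l =
  swap_right (coordinates2 M) i j k l.
Proof.
rewrite -[M in LHS]coordinates2K; set X := coordinates2 M.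
rewrite /swap_right coordinates2E expr2 invfM -scalerA; congr (_ *: _).
apply: (scalerI N_neq0); rewrite scalerA divff // scale1r.
rewrite [in RHS]exchange_big scaler_sumr /=.
under eq_bigr => p _ do rewrite (sum_reflect (p + j - l)).
rewrite exchange_big; apply: eq_bigr => b _ /=.
rewrite [in RHS](sum_reflect i) scaler_sumr.
transitivity (\sum_x \sum_z \sum_p chi (p * (z - (i + k - x))) *:
    (chi ((j - l - b) * (z - k)) *: X x (j - b) z (l + b))).
  rewrite [in RHS](eq_bigr _ (fun x _ => exchange_big _ _ _ _ _ _)) /=.
  rewrite [in RHS]exchange_big; apply: eq_bigr => p _ /=.
  rewrite entries2E scaler_sumr; apply: eq_bigr => x _.
  rewrite scaler_sumr; apply: eq_bigr => z _; rewrite !scale_chi.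
  by congr (chi _ *: X _ _ _ _); ring.
apply: eq_bigr => x _; rewrite sum_chi; congr (_ *: _).
by congr (chi _ *: X _ _ _ _); ring.
Qed.

(** The insertion of Q couples the two factors through the sum p + r instead
    of the difference p - r, so no index becomes free: the formula is a change
    of summation variables, r = - 1 - a' and p = a' - j + b. The signs become
    those of - 1 - a' and - 1 - (a' + b), hence the need for theta_opp. *)
Lemma coordinates_contract_left M i j k l :
  coordinates2 (fun p q r t =>
    (theta r * theta (- 1 - q)) *: M p (- 1 - r) (- 1 - q) t) i j k l =
  contract_left (coordinates2 M) i j k l.
Proof.
rewrite -[M in LHS]coordinates2K; set X := coordinates2 M.
rewrite /contract_left coordinates2E; congr (_ *: _).
rewrite exchange_big (sum_reflect (- 1)) /=.
under eq_bigr => a' _ do rewrite (sum_shift (a' - j)).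
rewrite [in RHS]exchange_big /=.
under [in RHS]eq_bigr => b _ do rewrite exchange_big /=.
rewrite [in RHS]exchange_big; apply: eq_bigr => a' _ /=.
apply: eq_bigr => b _; rewrite entries2E scaler_swap scaler_sumr scaler_sumr.
rewrite [in RHS]exchange_big /= (sum_reflect i); apply: eq_bigr => b' _.
rewrite scaler_sumr scaler_sumr (sum_shift k); apply: eq_bigr => a _.
rewrite theta_opp scale_chi -scalerA; congr (_ * theta _ *: _).
  by ring.
by congr (chi _ *: X _ _ _ _); ring.
Qed.

(** Same change of variables, now with p = a' and r = - 1 - l - a' - b. *)
Lemma coordinates_contract_right M i j k l :
  coordinates2 (fun p q r t =>
    (theta p * theta (- 1 - t)) *: M (- 1 - t) q r (- 1 - p)) i j k l =
  contract_right (coordinates2 M) i j k l.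
Proof.
rewrite -[M in LHS]coordinates2K; set X := coordinates2 M.
rewrite /contract_right coordinates2E; congr (_ *: _).
under eq_bigr => a' _ do rewrite (sum_reflect (- 1 - l - a')).
rewrite [in RHS]exchange_big /=.
under [in RHS]eq_bigr => b _ do rewrite exchange_big /=.
rewrite [in RHS]exchange_big; apply: eq_bigr => a' _ /=.
apply: eq_bigr => b _; rewrite entries2E scaler_swap scaler_sumr scaler_sumr.
rewrite [in RHS]exchange_big /= (sum_reflect i); apply: eq_bigr => b' _.
rewrite scaler_sumr scaler_sumr (sum_shift k); apply: eq_bigr => a _.
rewrite scale_chi -scalerA; congr (_ * theta _ *: _).
  by ring.
by congr (chi _ *: X _ _ _ _); ring.
Qed.

Lemma coordinates2D M M' i j k l :
  coordinates2 (fun p q r t => M p q r t + M' p q r t) i j k l =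
  coordinates2 M i j k l + coordinates2 M' i j k l.
Proof.
rewrite !coordinates2E -scalerDr -big_split; congr (_ *: _).
apply: eq_bigr => p _; rewrite -big_split; apply: eq_bigr => r _.
by rewrite scalerDr.
Qed.

Lemma coordinates2_linear (L : {linear V -> V}) M i j k l :
  coordinates2 (fun p q r t => L (M p q r t)) i j k l =
  L (coordinates2 M i j k l).
Proof.
rewrite /coordinates2 -coordinates_linear; last exact: linearP.
congr (coordinates _ i j); apply/funext => p; apply/funext => q.
by rewrite -coordinates_linear //; exact: linearP.
Qed.

Lemma coordinates2_bilinear (U W : lmodType K) (op : U -> W -> V) f h i j k l :
  (forall x, linear (op x)) -> (forall y, linear (op^~ y)) ->
  coordinates2 (fun p q r t => op (f p q) (h r t)) i j k l =
  op (coordinates f i j) (coordinates h k l).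
Proof.
move=> opl opr; rewrite -(coordinates_linear f i j (opr _)).
congr (coordinates _ i j); apply/funext => p; apply/funext => q.
by rewrite -coordinates_linear.
Qed.

Lemma coordinates2B M M' i j k l :
  coordinates2 (fun p q r t => M p q r t - M' p q r t) i j k l =
  coordinates2 M i j k l - coordinates2 M' i j k l.
Proof. by rewrite coordinates2D (coordinates2_linear -%R M'). Qed.

(** D and E stand for the multiplications by u + v and by u - v, and X1 and X2
    for the coordinates of S_1(u) S_2(v) and of S_2(v) S_1(u). *)
Definition quaternary_rhs_coordinates (D E : V -> V) X1 X2 i j k l : V :=
  D (swap_left X1 i j k l - swap_right X2 i j k l)
  - E (contract_left X1 i j k l - contract_right X2 i j k l)
  + (swap_left (contract_left X1) i j k l
     - swap_right (contract_right X2) i j k l).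

(** F stands for the multiplication by u^2 - v^2. All operations involved are
    linear and the transform is invertible, so it suffices to transform both
    sides. The last term of the right-hand side is the one with Q, with its row
    indices exchanged for M1 and its column indices exchanged for M2. *)
Lemma quaternary_coordinates (D E F : {linear V -> V}) M1 M2 :
  (forall p q r t, F (M1 p q r t - M2 p q r t) =
     D (M1 r q p t - M2 p t r q)
     - E ((theta r * theta (- 1 - q)) *: M1 p (- 1 - r) (- 1 - q) t
          - (theta p * theta (- 1 - t)) *: M2 (- 1 - t) q r (- 1 - p))
     + (theta p * theta (- 1 - q)) *:
         (M1 r (- 1 - p) (- 1 - q) t - M2 (- 1 - q) t r (- 1 - p))) <->
  (forall i j k l,
     F (coordinates2 M1 i j k l - coordinates2 M2 i j k l) =
     quaternary_rhs_coordinates D E (coordinates2 M1) (coordinates2 M2)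
       i j k l).
Proof.
pose lhs p q r t := F (M1 p q r t - M2 p q r t).
pose rhs p q r t := D (M1 r q p t - M2 p t r q)
     - E ((theta r * theta (- 1 - q)) *: M1 p (- 1 - r) (- 1 - q) t
          - (theta p * theta (- 1 - t)) *: M2 (- 1 - t) q r (- 1 - p))
     + (theta p * theta (- 1 - q)) *:
         (M1 r (- 1 - p) (- 1 - q) t - M2 (- 1 - q) t r (- 1 - p)).
have lhsE i j k l : coordinates2 lhs i j k l =
    F (coordinates2 M1 i j k l - coordinates2 M2 i j k l).
  by rewrite /lhs coordinates2_linear coordinates2B.
have cl : contract_left (coordinates2 M1) = coordinates2 (fun p q r t =>
    (theta r * theta (- 1 - q)) *: M1 p (- 1 - r) (- 1 - q) t).
  by apply/funext => i; apply/funext => j; apply/funext => k; apply/funext => l;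
    rewrite coordinates_contract_left.
have cr : contract_right (coordinates2 M2) = coordinates2 (fun p q r t =>
    (theta p * theta (- 1 - t)) *: M2 (- 1 - t) q r (- 1 - p)).
  by apply/funext => i; apply/funext => j; apply/funext => k; apply/funext => l;
    rewrite coordinates_contract_right.
have rhsE i j k l : coordinates2 rhs i j k l =
     quaternary_rhs_coordinates D E (coordinates2 M1) (coordinates2 M2) i j k l.
  rewrite /rhs /quaternary_rhs_coordinates coordinates2D coordinates2B.
  rewrite !coordinates2_linear.
  rewrite !coordinates2B cl cr -!coordinates_swap_left -!coordinates_swap_right.
  rewrite -[X in _ = _ + X]coordinates2B; congr (_ + coordinates2 _ i j k l).
  apply/funext => p; apply/funext => q; apply/funext => r; apply/funext => t.
  by rewrite scalerBr.
split=> [h i j k l|h p q r t].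
  rewrite -lhsE -rhsE; congr (coordinates2 _ i j k l).
  by apply/funext => p; apply/funext => q; apply/funext => r; apply/funext => t;
    exact: h.
have : coordinates2 lhs = coordinates2 rhs.
  by apply/funext => i; apply/funext => j; apply/funext => k; apply/funext => l;
    rewrite lhsE rhsE.
by move/(can_inj coordinates2K)/(congr1 (fun M => M p q r t)).
Qed.
(** * Explicit sums *)
Lemma swap_contract_leftE X i j k l :
  swap_left (contract_left X) i j k l =
  (N ^+ 3)^-1 *: \sum_a \sum_b \sum_a' \sum_b' \sum_c \sum_d
    (theta a' * theta (a' + b)
      * chi (- a - a' * (a + b') + b' * (j - b - d)
             - b * (k + a + c) + d * (i - k - c)))
      *: X (i - c - b') (j - d - b) (k + a + c) (l + b + d).
Proof.
rewrite /swap_left /contract_left (exprS _ 2) [in RHS]invfM -scalerA.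
congr (_ *: _).
transitivity ((N ^+ 2)^-1 *: \sum_c \sum_d \sum_a \sum_b \sum_a' \sum_b'
    (theta a' * theta (a' + b)
      * chi (- a - a' * (a + b') + b' * (j - b - d)
             - b * (k + a + c) + d * (i - k - c)))
      *: X (i - c - b') (j - d - b) (k + a + c) (l + b + d)).
  rewrite scaler_sumr; apply: eq_bigr => c _.
  rewrite scaler_sumr; apply: eq_bigr => d _.
  rewrite scaler_swap; congr (_ *: _).
  do 4!(rewrite scaler_sumr; apply: eq_bigr => ? _).
  rewrite scalerA mulrCA -chiD.
  by congr (_ * chi _ *: X _ _ _ _); ring.
congr (_ *: _); rewrite pair_big /=.
rewrite exchange_big; apply: eq_bigr => a _ /=.
rewrite exchange_big; apply: eq_bigr => b _ /=.
rewrite exchange_big; apply: eq_bigr => a' _ /=.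
by rewrite exchange_big; apply: eq_bigr => b' _ /=; rewrite pair_big.
Qed.

Lemma swap_contract_rightE X i j k l :
  swap_right (contract_right X) i j k l =
  (N ^+ 3)^-1 *: \sum_a \sum_b \sum_a' \sum_b' \sum_c \sum_d
    (theta a' * theta (a' + b)
      * chi (- a - a' * (a + b') + b * (i - c - b')
             - a * (l + b + d) + c * (j - l - d)))
      *: X (i - c - b') (j - d - b) (k + a + c) (l + b + d).
Proof.
rewrite /swap_right /contract_right (exprS _ 2) [in RHS]invfM -scalerA.
congr (_ *: _).
transitivity ((N ^+ 2)^-1 *: \sum_c \sum_d \sum_a \sum_b \sum_a' \sum_b'
    (theta a' * theta (a' + b)
      * chi (- a - a' * (a + b') + b * (i - c - b')
             - a * (l + b + d) + c * (j - l - d)))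
      *: X (i - c - b') (j - d - b) (k + a + c) (l + b + d)).
  rewrite scaler_sumr; apply: eq_bigr => c _.
  rewrite scaler_sumr; apply: eq_bigr => d _.
  rewrite scaler_swap; congr (_ *: _).
  do 4!(rewrite scaler_sumr; apply: eq_bigr => ? _).
  rewrite scalerA mulrCA -chiD.
  by congr (_ * chi _ *: X _ _ _ _); ring.
congr (_ *: _); rewrite pair_big /=.
rewrite exchange_big; apply: eq_bigr => a _ /=.
rewrite exchange_big; apply: eq_bigr => b _ /=.
rewrite exchange_big; apply: eq_bigr => a' _ /=.
by rewrite exchange_big; apply: eq_bigr => b' _ /=; rewrite pair_big.
Qed.

Lemma swapB X1 X2 i j k l :
  swap_left X1 i j k l - swap_right X2 i j k l = N^-1 *: \sum_a \sum_b
    (chi (b * (i - k - a)) *: X1 (i - a) (j - b) (k + a) (l + b)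
     - chi (a * (j - l - b)) *: X2 (i - a) (j - b) (k + a) (l + b)).
Proof.
rewrite -scalerBr -sumrB; congr (_ *: _); apply: eq_bigr => a _.
by rewrite -sumrB.
Qed.

Lemma quaternary_rhs_coordinatesE (D E : {linear V -> V}) X1 X2 i j k l :
  quaternary_rhs_coordinates D E X1 X2 i j k l =
    N^-1 *: D (\sum_a \sum_b
      (chi (b * (i - k - a)) *: X1 (i - a) (j - b) (k + a) (l + b)
       - chi (a * (j - l - b)) *: X2 (i - a) (j - b) (k + a) (l + b)))
  - (N ^+ 2)^-1 *: E (\sum_a \sum_b \sum_a' \sum_b'
      (theta a' * theta (a' + b)
        * chi (- a - a' * (a + b') + b' * (j - b) - b * (k + a)))
        *: X1 (i - b') (j - b) (k + a) (l + b))
  + (N ^+ 2)^-1 *: E (\sum_a \sum_b \sum_a' \sum_b'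
      (theta a' * theta (a' + b)
        * chi (- a - a' * (a + b') + b * (i - b') - a * (l + b)))
        *: X2 (i - b') (j - b) (k + a) (l + b))
  + (N ^+ 3)^-1 *: (\sum_a \sum_b \sum_a' \sum_b' \sum_c \sum_d
      (theta a' * theta (a' + b)
        * chi (- a - a' * (a + b') + b' * (j - b - d)
               - b * (k + a + c) + d * (i - k - c)))
        *: X1 (i - c - b') (j - d - b) (k + a + c) (l + b + d))
  - (N ^+ 3)^-1 *: (\sum_a \sum_b \sum_a' \sum_b' \sum_c \sum_d
      (theta a' * theta (a' + b)
        * chi (- a - a' * (a + b') + b * (i - c - b')
               - a * (l + b + d) + c * (j - l - d)))
        *: X2 (i - c - b') (j - d - b) (k + a + c) (l + b + d)).
Proof.
rewrite /quaternary_rhs_coordinates swap_contract_leftE swap_contract_rightE.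
rewrite addrA; congr (_ + _ - _); rewrite [E _]linearB opprB addrCA addrC.
by rewrite swapB -!linearZZ.
Qed.

(** * The orthogonal case *)
Hypothesis theta1 : forall x, theta x = 1.

(** With theta = 1 the index a' occurs only in the character, through
    - a' (a + b'), so that b' = - a. *)
Lemma contract_left_orthogonal X i j k l :
  contract_left X i j k l =
  N^-1 *: \sum_a \sum_b
    chi (- a - a * j - b * k) *: X (i + a) (j - b) (k + a) (l + b).
Proof.
rewrite /contract_left expr2 invfM -scalerA; congr (_ *: _).
apply: (scalerI N_neq0); rewrite scalerA divff // scale1r.
rewrite scaler_sumr; apply: eq_bigr => a _.
rewrite scaler_sumr; apply: eq_bigr => b _.
rewrite exchange_big /= (sum_reflect 0).
transitivity (\sum_b' \sum_a' chi (a' * (b' - a)) *: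
    (chi (- a - b' * (j - b) - b * (k + a))
       *: X (i + b') (j - b) (k + a) (l + b))).
  apply: eq_bigr => b' _; apply: eq_bigr => a' _.
  rewrite !theta1 !mul1r scale_chi.
  by congr (chi _ *: X _ _ _ _); ring.
rewrite sum_chi; congr (_ *: _).
by congr (chi _ *: X _ _ _ _); ring.
Qed.

Lemma contract_right_orthogonal X i j k l :
  contract_right X i j k l =
  N^-1 *: \sum_a \sum_b
    chi (- a + b * i - l * a) *: X (i + a) (j - b) (k + a) (l + b).
Proof.
rewrite /contract_right expr2 invfM -scalerA; congr (_ *: _).
apply: (scalerI N_neq0); rewrite scalerA divff // scale1r.
rewrite scaler_sumr; apply: eq_bigr => a _.
rewrite scaler_sumr; apply: eq_bigr => b _.
rewrite exchange_big /= (sum_reflect 0).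
transitivity (\sum_b' \sum_a' chi (a' * (b' - a)) *:
    (chi (- a + b * (i + b') - a * (l + b))
       *: X (i + b') (j - b) (k + a) (l + b))).
  apply: eq_bigr => b' _; apply: eq_bigr => a' _.
  rewrite !theta1 !mul1r scale_chi.
  by congr (chi _ *: X _ _ _ _); ring.
rewrite sum_chi; congr (_ *: _).
by congr (chi _ *: X _ _ _ _); ring.
Qed.

Lemma swap_contract_left_orthogonal X i j k l :
  swap_left (contract_left X) i j k l =
  (N ^+ 2)^-1 *: \sum_a \sum_b \sum_a' \sum_b'
    chi (- a - a * j + b' * (a - k + i - a') - b * (k + a'))
      *: X (i + a - a') (j - b - b') (k + a + a') (l + b + b').
Proof.
rewrite /swap_left expr2 invfM -scalerA; congr (_ *: _).
transitivity (N^-1 *: \sum_c \sum_d \sum_a \sum_b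
    chi (- a - a * j + d * (a - k + i - c) - b * (k + c))
      *: X (i + a - c) (j - b - d) (k + a + c) (l + b + d)).
  rewrite scaler_sumr; apply: eq_bigr => c _.
  rewrite scaler_sumr; apply: eq_bigr => d _.
  rewrite contract_left_orthogonal scaler_swap; congr (_ *: _).
  do 2!(rewrite scaler_sumr; apply: eq_bigr => ? _).
  by rewrite scale_chi; congr (chi _ *: X _ _ _ _); ring.
congr (_ *: _); rewrite pair_big /=.
rewrite exchange_big; apply: eq_bigr => a _ /=.
by rewrite exchange_big; apply: eq_bigr => b _ /=; rewrite pair_big.
Qed.

Lemma swap_contract_right_orthogonal X i j k l :
  swap_right (contract_right X) i j k l =
  (N ^+ 2)^-1 *: \sum_a \sum_b \sum_a' \sum_b'
    chi (- a + b * i + a' * (j - b - b' - l) - a * (l + b'))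
      *: X (i + a - a') (j - b - b') (k + a + a') (l + b + b').
Proof.
rewrite /swap_right expr2 invfM -scalerA; congr (_ *: _).
transitivity (N^-1 *: \sum_c \sum_d \sum_a \sum_b
    chi (- a + b * i + c * (j - b - d - l) - a * (l + d))
      *: X (i + a - c) (j - b - d) (k + a + c) (l + b + d)).
  rewrite scaler_sumr; apply: eq_bigr => c _.
  rewrite scaler_sumr; apply: eq_bigr => d _.
  rewrite contract_right_orthogonal scaler_swap; congr (_ *: _).
  do 2!(rewrite scaler_sumr; apply: eq_bigr => ? _).
  by rewrite scale_chi; congr (chi _ *: X _ _ _ _); ring.
congr (_ *: _); rewrite pair_big /=.
rewrite exchange_big; apply: eq_bigr => a _ /=.
by rewrite exchange_big; apply: eq_bigr => b _ /=; rewrite pair_big.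
Qed.

Lemma quaternary_rhs_coordinates_orthogonal (D E : {linear V -> V})
    X1 X2 i j k l :
  quaternary_rhs_coordinates D E X1 X2 i j k l =
    N^-1 *: D (\sum_a \sum_b
      (chi (b * (i - k - a)) *: X1 (i - a) (j - b) (k + a) (l + b)
       - chi (a * (j - l - b)) *: X2 (i - a) (j - b) (k + a) (l + b)))
  + N^-1 *: E (\sum_a \sum_b
      (chi (- a + b * i - l * a) *: X2 (i + a) (j - b) (k + a) (l + b)
       - chi (- a - a * j - b * k) *: X1 (i + a) (j - b) (k + a) (l + b)))
  + (N ^+ 2)^-1 *: (\sum_a \sum_b \sum_a' \sum_b'
      chi (- a - a * j + b' * (a - k + i - a') - b * (k + a'))
        *: X1 (i + a - a') (j - b - b') (k + a + a') (l + b + b'))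
  - (N ^+ 2)^-1 *: (\sum_a \sum_b \sum_a' \sum_b'
      chi (- a + b * i + a' * (j - b - b' - l) - a * (l + b'))
        *: X2 (i + a - a') (j - b - b') (k + a + a') (l + b + b')).
Proof.
rewrite /quaternary_rhs_coordinates.
rewrite swap_contract_left_orthogonal swap_contract_right_orthogonal.
rewrite addrA; congr (_ + _ - _); rewrite swapB -linearN opprB -!linearZZ.
congr (_ + E _); rewrite contract_left_orthogonal contract_right_orthogonal.
rewrite -scalerBr -sumrB; congr (_ *: _); apply: eq_bigr => a _.
by rewrite -sumrB.
Qed.

End Coordinates2.

(** * The transposition *)
Section Transposition.
Variables (V : lmodType K) (theta : A -> K).

Definition transpose_coordinates (X : A -> A -> V) (i j : A) : V :=
  N^-1 *: \sum_k \sum_l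
    (theta k * theta (k + j) * chi (- l * (1 + j) - k * (i + l))) *: X l j.

(** The transposition preserves the difference of the indices, since
    (- 1 - p) - (- 1 - q) = q - p; only the character index is transformed. *)
Lemma coordinates_transpose (M : A -> A -> V) i j :
  coordinates (fun p q => (theta p * theta q) *: M (- 1 - q) (- 1 - p)) i j =
  transpose_coordinates (coordinates M) i j.
Proof.
rewrite -[M in LHS]coordinatesK; set X := coordinates M.
congr (_ *: _); apply: eq_bigr => k _.
rewrite /entries scaler_swap !scaler_sumr; apply: eq_bigr => l _.
rewrite scale_chi scalerA.
congr (_ * chi _ *: X _ _); ring.
Qed.

Lemma transpose_coordinates_orthogonal X i j : (forall x, theta x = 1) ->
  transpose_coordinates X i j = chi (i * (1 + j)) *: X (- i) j.
Proof.
move=> theta1; apply: (scalerI N_neq0).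
rewrite /transpose_coordinates [LHS]scalerA divff // scale1r (sum_reflect 0).
rewrite exchange_big.
transitivity (\sum_l \sum_k
    chi (k * (l - - i)) *: (chi (- l * (1 + j)) *: X l j)).
  apply: eq_bigr => l _; apply: eq_bigr => k _.
  rewrite !theta1 !mul1r scale_chi.
  by congr (chi _ *: X _ _); ring.
by rewrite sum_chi opprK.
Qed.

End Transposition.
End Fourier.

(** * The ring Z/N and its character *)

(** A copy of the ordinals with the ring structure of Z/N for every N >= 1,
    the zero ring for N = 1 included. *)
Definition cyclic_ring (n : nat) := 'I_n.+1.

HB.instance Definition _ n := Finite.copy (cyclic_ring n) 'I_n.+1.
HB.instance Definition _ n := GRing.Zmodule.copy (cyclic_ring n) 'I_n.+1.
HB.instance Definition _ n := GRing.Zmodule_isComPzRing.Build (cyclic_ring n)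
  (@Zp_mulA n.+1) (@Zp_mulC n.+1) (@Zp_mul1z n) (@Zp_mul_addl n.+1).

Lemma natr_cyclic n (k : nat) : k%:R = inZp k :> cyclic_ring n.
Proof.
elim: k => [|k IH]; first by apply: val_inj; rewrite /= mod0n.
by rewrite -natr1 IH; apply: val_inj; rewrite /= modnDm addn1.
Qed.

Lemma natr_val n (x : cyclic_ring n) : (x : nat)%:R = x.
Proof. by rewrite natr_cyclic valZpK. Qed.

Lemma rev_ordE n (x : cyclic_ring n) : rev_ord x = - 1 - x :> cyclic_ring n.
Proof.
apply/eqP; rewrite eq_sym subr_eq -subr_eq0 -opprD oppr_eq0; apply/eqP.
rewrite -[rev_ord x]natr_val -[X in _ + (_ + X)]natr_val.
rewrite -natrD nat1r natr_cyclic.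
by apply: val_inj; rewrite /= -addSn subnSK // subnK ?modnn // ltnW.
Qed.

Section CyclicCharacter.
Variables (R : realType) (g : twisted_type).
Local Notation omega := (omega R g).
Local Notation A := (cyclic_ring (pred_dim g)).

Definition character (x : A) : R[i] := omega ^+ x.

Lemma characterD x y : character (x + y) = character x * character y.
Proof.
by rewrite /character -exprD /= (prim_expr_mod (omega_prim R g)).
Qed.

(** Exponents of omega in the relations are integer polynomials in the values
    of indices; only their residues modulo N matter, and these are the same
    polynomials in the indices themselves. *)
Definition residue (e : int) : A := e%:~R.

Lemma residueE : (forall e f, residue (e + f) = residue e + residue f)
  * (forall e, residue (- e) = - residue e)
  * (forall e f, residue (e * f) = residue e * residue f)
  * (residue 1 = 1)
  * (forall i : idx g, residue (Posz i) = i :> A).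
Proof.
by do !split=> *; rewrite /residue ?(rmorphD, rmorphN, rmorphM) //;
  exact: natr_val.
Qed.

Lemma omegaZ (e : int) : omega ^ e = character (residue e).
Proof.
have wX (k : nat) : omega ^+ k = character k%:R.
  by rewrite /character natr_cyclic /= (prim_expr_mod (omega_prim R g)).
case: e => k; first exact: wX.
rewrite NegzE -exprnN residueE wX; apply: mulr1_eq.
by rewrite -characterD subrr.
Qed.

Lemma character_nondegenerate : nondegenerate_character character.
Proof.
split=> [|x]; first exact: characterD.
transitivity (if x == 0 then (pred_dim g).+1%:R else 0 : R[i]); last first.
  by rewrite card_ord; case: eqP.
apply: etrans (sum_omega R x 0).
apply: eq_bigr => p _; rewrite mul0n expr0 invr1 mulr1.
by rewrite /character /= (prim_expr_mod (omega_prim R g)) mulnC.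
Qed.

Lemma card_cyclic_neq0 : #|A|%:R != 0 :> R[i].
Proof. by rewrite card_ord pnatr_eq0. Qed.

Lemma theta_opp (x y : A) :
  theta R (- 1 - x : A) * theta R (- 1 - y : A) = theta R x * theta R y.
Proof. by rewrite -!rev_ordE; exact: theta_rev. Qed.

End CyclicCharacter.

(** * Linearity of the operations on formal series *)
Section SeriesOperators.
Variables (K : fieldType) (B : algType K).
Local Notation V1 := (int -> B).
Local Notation V2 := (int -> int -> B).

Lemma mul_uDv_linear : linear (@mul_uDv K B).
Proof.
move=> c F G; apply/funext => p; apply/funext => q.
by rewrite /mul_uDv /mul_u /mul_v !(addrfctE, scalrfctE) scalerDr addrACA.
Qed.

Lemma mul_uBv_linear : linear (@mul_uBv K B).
Proof.
move=> c F G; apply/funext => p; apply/funext => q.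
rewrite /mul_uBv /mul_u /mul_v !(addrfctE, opprfctE, scalrfctE).
by rewrite scalerBr opprD addrACA.
Qed.

Lemma mul_u2Bv2_linear : linear (@mul_u2Bv2 K B).
Proof.
move=> c F G; apply/funext => p; apply/funext => q.
rewrite /mul_u2Bv2 /mul_u /mul_v !(addrfctE, opprfctE, scalrfctE).
by rewrite scalerBr opprD addrACA.
Qed.

Lemma neg_arg_linear : linear (@neg_arg K B).
Proof.
move=> c f h; apply/funext => p.
by rewrite /neg_arg !(addrfctE, scalrfctE) scalerDr !scalerA mulrC.
Qed.

Lemma div_u_linear : linear (@div_u K B).
Proof. by []. Qed.

HB.instance Definition _ :=
  GRing.isLinear.Build K V2 V2 *:%R (@mul_uDv K B) mul_uDv_linear.
HB.instance Definition _ :=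
  GRing.isLinear.Build K V2 V2 *:%R (@mul_uBv K B) mul_uBv_linear.
HB.instance Definition _ :=
  GRing.isLinear.Build K V2 V2 *:%R (@mul_u2Bv2 K B) mul_u2Bv2_linear.

Lemma at_uv_linearl (h : V1) : linear (fun f : V1 => at_uv f h).
Proof.
move=> c f f'; apply/funext => p; apply/funext => q.
by rewrite /at_uv !(addrfctE, scalrfctE) mulrDl scalerAl.
Qed.

Lemma at_uv_linearr (f : V1) : linear (at_uv f).
Proof.
move=> c h h'; apply/funext => p; apply/funext => q.
by rewrite /at_uv !(addrfctE, scalrfctE) mulrDr scalerAr.
Qed.

Lemma at_vu_linearl (h : V1) : linear (fun f : V1 => at_vu f h).
Proof.
move=> c f f'; apply/funext => p; apply/funext => q.
by rewrite /at_vu !(addrfctE, scalrfctE) mulrDl scalerAl.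
Qed.

Lemma at_vu_linearr (f : V1) : linear (at_vu f).
Proof.
move=> c h h'; apply/funext => p; apply/funext => q.
by rewrite /at_vu !(addrfctE, scalrfctE) mulrDr scalerAr.
Qed.

End SeriesOperators.

(** * Twisted relations and principal relations *)
Section Comparison.
Variables (R : realType) (g : twisted_type) (B : algType R[i]).
Variables s y : idx g -> idx g -> nat -> B.
Hypothesis sy : principal_generators s y.
Local Notation A := (cyclic_ring (pred_dim g)).
Local Notation chi := (@character R g).
Local Notation S := (fun i j : A => useries (s_coef s i j)).
Local Notation Y := (fun i j : A => useries (y i j)).
Local Notation theta := (@Defs.theta R g : A -> R[i]).

Let chiP := character_nondegenerate R g.
Let N_neq0 := card_cyclic_neq0 R g.

(** The principal generators are the coordinates of S(u), coefficient by
    coefficient. *)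
Lemma coordinates_S : coordinates chi S = Y.
Proof.
rewrite -[Y](entriesK chiP N_neq0); congr (coordinates chi _).
apply/funext => p; apply/funext => q; apply/funext => e.
rewrite /entries fct_sumE.
have yE r : s_coef s p q r = \sum_(k : A) chi (p * k) *: y k (q - p) r.
  have := congr1 (fun M : 'M_((pred_dim g).+1) => M p q) (sy r).
  rewrite sum_tens_Amx mxE => ->; apply: eq_bigr => k _; congr (_ *: _).
  by rewrite /character /= (prim_expr_mod (omega_prim R g)).
case: e => [[|r]|r]; [exact: (yE 0%N) | | exact: (yE r.+1)].
by rewrite big1 // => k _; exact: scaler0.
Qed.

Lemma quaternary_series :
  (forall i j k l, quaternary_lhs s i j k l = quaternary_rhs s i j k l) <->
  forall i j k l : A, mul_u2Bv2 (comm_uv (Y i j) (Y k l)) =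
    quaternary_rhs_coordinates chi theta (@mul_uDv _ B) (@mul_uBv _ B)
      (fun i j k l => at_uv (Y i j) (Y k l))
      (fun i j k l => at_vu (Y k l) (Y i j))
      i j k l.
Proof.
pose M1 (p q r t : A) := at_uv (S p q) (S r t).
pose M2 (p q r t : A) := at_vu (S r t) (S p q).
have X1 : coordinates2 chi M1 = fun i j k l => at_uv (Y i j) (Y k l).
  apply/funext => i; apply/funext => j; apply/funext => k; apply/funext => l.
  transitivity (at_uv (coordinates chi S i j) (coordinates chi S k l));
    last by rewrite coordinates_S.
  apply: (coordinates2_bilinear chi (op := @at_uv _ B)).
    exact: at_uv_linearr.
  exact: at_uv_linearl.
have X2 : coordinates2 chi M2 = fun i j k l => at_vu (Y k l) (Y i j).
  apply/funext => i; apply/funext => j; apply/funext => k; apply/funext => l.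
  transitivity (at_vu (coordinates chi S k l) (coordinates chi S i j));
    last by rewrite coordinates_S.
  apply: (coordinates2_bilinear chi (op := fun f h => @at_vu _ B h f)).
    exact: at_vu_linearl.
  exact: at_vu_linearr.
have := quaternary_coordinates chiP N_neq0 (@theta_opp R g)
  (@mul_uDv _ B) (@mul_uBv _ B) (@mul_u2Bv2 _ B) M1 M2.
rewrite X1 X2 => <-.
have revE (i : idx g) : rev_ord i = - 1 - (i : A) := rev_ordE i.
split=> h p q r t; have := h p q r t.
  by rewrite /quaternary_lhs /quaternary_rhs !revE.
by rewrite /quaternary_lhs /quaternary_rhs !revE.
Qed.

Lemma principal_quaternaryE i j k l : principal_quaternary y i j k l <->
  mul_u2Bv2 (comm_uv (Y i j) (Y k l)) =
    quaternary_rhs_coordinates chi theta (@mul_uDv _ B) (@mul_uBv _ B)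
      (fun i j k l => at_uv (Y i j) (Y k l))
      (fun i j k l => at_vu (Y k l) (Y i j))
      i j k l.
Proof.
rewrite /principal_quaternary (quaternary_rhs_coordinatesE chiP) card_ord.
set x := (X in _ = X <-> _); set x' := (X in _ <-> _ = X).
suff -> : x = x' by [].
rewrite /x /x'; congr (_ - _ + _ + _ - _); congr (_ *: _).
- congr mul_uDv; do 2!(apply: eq_bigr => ? _).
  by rewrite !omegaZ !residueE.
- congr mul_uBv; do 4!(apply: eq_bigr => ? _).
  by rewrite !omegaZ !residueE.
- congr mul_uBv; do 4!(apply: eq_bigr => ? _).
  by rewrite !omegaZ !residueE.
- do 6!(apply: eq_bigr => ? _).
  by rewrite !omegaZ !residueE.
- do 6!(apply: eq_bigr => ? _).
  by rewrite !omegaZ !residueE.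
Qed.

Lemma symmetry_series :
  (forall i j, symmetry_lhs s i j = symmetry_rhs s i j) <->
  forall i j : A,
    transpose_coordinates chi theta (fun i j => neg_arg (Y i j)) i j =
    Y i j + pm_sign R g *: (2^-1 *: div_u (Y i j - neg_arg (Y i j))).
Proof.
pose L (f : int -> B) : int -> B :=
  f + pm_sign R g *: (2^-1 *: div_u (f - neg_arg f)).
have L_lin : linear L.
  move=> c f h; rewrite /L neg_arg_linear opprD addrACA -scalerBr div_u_linear.
  by rewrite !scalerDr !(scaler_swap _ c) addrACA.
have negY : coordinates chi (fun p q => neg_arg (S p q)) =
    fun i j => neg_arg (Y i j).
  apply/funext => i; apply/funext => j.
  rewrite (coordinates_linear chi S i j (@neg_arg_linear _ B)).
  by rewrite coordinates_S.
have LY : coordinates chi (fun p q => L (S p q)) = fun i j => L (Y i j).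
  apply/funext => i; apply/funext => j.
  by rewrite (coordinates_linear chi S i j L_lin) coordinates_S.
have revE (i : idx g) : rev_ord i = - 1 - (i : A) := rev_ordE i.
have lhsE : coordinates chi (@symmetry_lhs R g B s) =
    transpose_coordinates chi theta (fun i j => neg_arg (Y i j)).
  apply/funext => i; apply/funext => j.
  rewrite -negY -(coordinates_transpose chiP N_neq0).
  congr (coordinates chi _ i j); apply/funext => p; apply/funext => q.
  by rewrite /symmetry_lhs !revE.
split=> [h i j|h i j].
  rewrite -lhsE -[RHS]/((fun i j => L (Y i j)) i j) -LY.
  by congr (coordinates chi _ i j); apply/funext => p; apply/funext => q;
    exact: h.
have E : coordinates chi (@symmetry_lhs R g B s) =
    coordinates chi (fun p q => L (S p q)).
  by rewrite lhsE LY; apply/funext => p; apply/funext => q; exact: h.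
have {E} E := can_inj (@coordinatesK _ _ _ chiP N_neq0 _) E.
exact: (congr1 (fun M => M i j) E).
Qed.

Lemma principal_symmetryE i j : principal_symmetry y i j <->
  transpose_coordinates chi theta (fun i j => neg_arg (Y i j)) i j =
    Y i j + pm_sign R g *: (2^-1 *: div_u (Y i j - neg_arg (Y i j))).
Proof.
rewrite /principal_symmetry /transpose_coordinates card_ord.
set x := (X in X = _ <-> _); set x' := (X in _ <-> X = _).
suff -> : x = x' by [].
congr (_ *: _); do 2!(apply: eq_bigr => ? _).
by rewrite omegaZ !residueE.
Qed.

Lemma twisted_relationsE : twisted_relations s <-> principal_relations y.
Proof.
split=> -[h1 h2]; split.
- move=> i j k l; apply/principal_quaternaryE; move: i j k l.
  by apply/quaternary_series.
- by move=> i j; apply/principal_symmetryE; move: i j; apply/symmetry_series.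
- by apply/quaternary_series => i j k l; apply/principal_quaternaryE.
- by apply/symmetry_series => i j; apply/principal_symmetryE.
Qed.

End Comparison.

(** * Reduced relations of the orthogonal case *)
Section Orthogonal.
Variables (R : realType) (m : nat) (B : algType R[i]).
Local Notation g := (SO m).
Variable y : idx g -> idx g -> nat -> B.

Lemma so_quaternaryE i j k l :
  so_quaternary y i j k l <-> principal_quaternary y i j k l.
Proof.
rewrite principal_quaternaryE /so_quaternary.
rewrite (quaternary_rhs_coordinates_orthogonal (character_nondegenerate R g)
  (card_cyclic_neq0 R g)) // card_ord.
set x := (X in _ = X <-> _); set x' := (X in _ <-> _ = X).
suff -> : x = x' by [].
rewrite /x /x'; congr (_ + _ + _ - _); congr (_ *: _).
- by congr mul_uDv; do 2!(apply: eq_bigr => ? _); rewrite !omegaZ !residueE.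
- by congr mul_uBv; do 2!(apply: eq_bigr => ? _); rewrite !omegaZ !residueE.
- by do 4!(apply: eq_bigr => ? _); rewrite !omegaZ !residueE.
- by do 4!(apply: eq_bigr => ? _); rewrite !omegaZ !residueE.
Qed.

Lemma so_symmetryE i j : so_symmetry y i j <-> principal_symmetry y i j.
Proof.
rewrite principal_symmetryE /so_symmetry.
rewrite (transpose_coordinates_orthogonal (character_nondegenerate R g)
  (card_cyclic_neq0 R g)) // scale1r.
by rewrite omegaZ !residueE.
Qed.

Lemma so_relationsE : so_relations y <-> principal_relations y.
Proof.
split=> -[h1 h2]; split=> *; by [apply/so_quaternaryE | apply/so_symmetryE].
Qed.

End Orthogonal.

Theorem theorem4p2 (R : realType) :
  (forall (g : twisted_type) (y : idx g -> idx g -> nat -> twisted_yangian R g),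
     principal_generators (@twisted_s R g) y -> principal_relations y) /\
  (forall m : nat,
     (forall y : idx (SO m) -> idx (SO m) -> nat -> twisted_yangian R (SO m),
        principal_generators (@twisted_s R (SO m)) y -> so_relations y) /\
     (forall (B : algType R[i]) (s y : idx (SO m) -> idx (SO m) -> nat -> B),
        principal_generators s y ->
        (twisted_relations s <-> so_relations y))).
Proof.
split=> [g y sy|m].
  exact: (proj1 (twisted_relationsE sy) (twisted_sP R g)).
split=> [y sy|B s y sy].
  apply: (proj2 (so_relationsE y)).
  exact: (proj1 (twisted_relationsE sy) (twisted_sP R (SO m))).
by rewrite (twisted_relationsE sy) so_relationsE.
Qed.
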